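(* The duality yielded by $\mathbf S=\langle S;\{r_1,r_2,r_3\},\mathcal T\rangle$ on $\mathcal A=ISP(\mathbb S)$ is neither full nor strong.
   Context: $\mathbb{S}$ is the three-element Boolean semiring with carrier $S=\{0,h,1\}$: multiplication is the minimum for the chain $0<h<1$, and addition is commutative with $0+x=x$, $1+1=h$, $h+h=h$, $1+h=1$. Equivalently (up to term equivalence) it is the chain $0<h<1$ with constants $0,h,1$, $\wedge=\min$, $\vee=\max$ and unary operation $\overline{x}=1+x$ ($\overline0=\overline h=1$, $\overline1=h$). $\mathcal A=ISP(\mathbb S)$ is the quasi-variety generated by $\mathbb S$; $\mathcal A(A,B)$ is the set of homomorphisms. $\mathcal T$ is the discrete topology, $r_1=S^2\setminus\{(1,0)\}$, $r_2=S^2\setminus\{(h,0),(1,0)\}$, $r_3=S^2\setminus\{(0,1),(h,1),(1,0),(1,h)\}$ (all subalgebras of $\mathbb S^2$). $\mathcal X=IS_cP^+(\mathbf S)$ is the category of isomorphic copies of topologically closed (possibly empty) substructures of powers of $\mathbf S$ over non-empty index sets, with coordinatewise relations; morphisms are continuous relation-preserving maps. For $A\in\mathcal A$, $D(A)=\mathcal A(A,\mathbb S)$ as a closed substructure of $\mathbf S^A$; for $X\in\mathcal X$, $E(X)=\mathcal X(X,\mathbf S)$ as a subalgebra of $\mathbb S^X$. $\mathbf S$ yields a duality on $\mathcal A$ if every evaluation map $e_A:A\to ED(A)$, $e_A(a)(x)=x(a)$, is an isomorphism; a full duality if moreover every evaluation map $\varepsilon_X:X\to DE(X)$, $\varepsilon_X(x)(f)=f(x)$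 $(X\in\mathcal X)$, is an isomorphism; a strong duality if it yields a full duality and $\mathbf S$ is injective in $\mathcal X$ (every morphism to $\mathbf S$ from a closed substructure of an object of $\mathcal X$ extends to the whole object). *)

(* Defs.v *)
From HB Require Import structures.
From mathcomp Require Import all_boot all_order all_algebra.
From mathcomp Require Import all_classical.
From mathcomp Require Import topology.

Set Implicit Arguments.
Unset Strict Implicit.
Unset Printing Implicit Defensive.

Import GRing.Theory.
Local Open Scope classical_set_scope.
Local Open Scope ring_scope.

Inductive bs3 : Type := s0 | sh | s1.

Definition bs3_ord (x : bs3) : 'I_3 :=
  match x with
  | s0 => @Ordinal 3 0 isT
  | sh => @Ordinal 3 1 isT
  | s1 => @Ordinal 3 2 isT
  end.

Definition ord_bs3 (i : 'I_3) : bs3 :=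
  match val i with 0%N => s0 | 1%N => sh | _ => s1 end.

Lemma bs3_ordK : cancel bs3_ord ord_bs3.
Proof. by case. Qed.

HB.instance Definition _ := Finite.copy bs3 (can_type bs3_ordK).

Definition bs3_add (x y : bs3) : bs3 :=
  match x, y with
  | s0, z | z, s0 => z
  | s1, s1 | sh, sh => sh
  | s1, sh | sh, s1 => s1
  end.

Definition bs3_mul (x y : bs3) : bs3 :=
  match x, y with
  | s0, _ | _, s0 => s0
  | sh, _ | _, sh => sh
  | s1, s1 => s1
  end.

Lemma bs3_addA : associative bs3_add. Proof. by do 3!case. Qed.
Lemma bs3_addC : commutative bs3_add. Proof. by do 2!case. Qed.
Lemma bs3_add0 : left_id s0 bs3_add. Proof. by case. Qed.
Lemma bs3_mulA : associative bs3_mul. Proof. by do 3!case. Qed.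
Lemma bs3_mulC : commutative bs3_mul. Proof. by do 2!case. Qed.
Lemma bs3_mul1 : left_id s1 bs3_mul. Proof. by case. Qed.
Lemma bs3_mulDl : left_distributive bs3_mul bs3_add. Proof. by do 3!case. Qed.
Lemma bs3_mul0 : left_zero s0 bs3_mul. Proof. by []. Qed.

HB.instance Definition _ :=
  GRing.isNmodule.Build bs3 bs3_addA bs3_addC bs3_add0.

(* The constant h is the term 1 + 1, so it is preserved by every semiring
   morphism. *)
HB.instance Definition _ := GRing.Nmodule_isComPzSemiRing.Build bs3
  bs3_mulA bs3_mulC bs3_mul1 bs3_mulDl bs3_mul0.

HB.instance Definition _ := hasNbhs.Build bs3 principal_filter.
HB.instance Definition _ := Discrete_ofNbhs.Build bs3 erefl.

Inductive rsym : Type := R1 | R2 | R3.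

HB.mixin Record hasRels X := { rels : rsym -> X -> X -> Prop }.

#[short(type="relSpaceType")]
HB.structure Definition RelSpace := { X of Topological X & hasRels X }.

Definition bs3_rels (k : rsym) (x y : bs3) : Prop :=
  match k with
  | R1 => (x, y) \notin [:: (s1, s0)]
  | R2 => (x, y) \notin [:: (sh, s0); (s1, s0)]
  | R3 => (x, y) \notin [:: (s0, s1); (sh, s1); (s1, s0); (s1, sh)]
  end.

HB.instance Definition _ := hasRels.Build bs3 bs3_rels.

Definition is_morphism (X Y : relSpaceType) (f : X -> Y) : Prop :=
  continuous f /\ forall k x y, rels k x y -> rels k (f x) (f y).

Definition is_isomorphism (X Y : relSpaceType) (f : X -> Y) : Prop :=
  is_morphism f /\
  exists g : Y -> X, [/\ is_morphism g, cancel f g & cancel g f].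

(* On [set_type C] the library already puts the subspace topology. *)
HB.instance Definition _ (X : relSpaceType) (C : set X) :=
  hasRels.Build (set_type C) (fun k x y => rels k (set_val x) (set_val y)).

(* An alias of [I -> bs3] carrying both the pointwise algebra structure and the
   structure of a topological power with coordinatewise relations. *)
Definition pow (I : Type) : Type := I -> bs3.

Section Power.
Variable I : Type.
Implicit Types f g h : pow I.

HB.instance Definition _ := GRing.Nmodule.copy (pow I) (I -> bs3).

Let mul f g : pow I := fun i => f i * g i.
Let one : pow I := fun=> 1.

Let mulA : associative mul.
Proof. by move=> f g h; apply/funext => i; exact: mulrA. Qed.
Let mulC : commutative mul.
Proof. by move=> f g; apply/funext => i; exact: mulrC. Qed.
Let mul1 : left_id one mul.
Proof. by move=> f; apply/funext => i; exact: mul1r. Qed.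
Let mulDl : left_distributive mul +%R.
Proof. by move=> f g h; apply/funext => i; exact: mulrDl. Qed.
Let mul0 : left_zero 0 mul.
Proof. by move=> f; apply/funext => i; exact: mul0r. Qed.

HB.instance Definition _ :=
  GRing.Nmodule_isComPzSemiRing.Build (pow I) mulA mulC mul1 mulDl mul0.

HB.instance Definition _ :=
  Topological.copy (pow I) (prod_topology (fun _ : I => bs3)).

HB.instance Definition _ :=
  hasRels.Build (pow I) (fun k f g => forall i, rels k (f i) (g i)).

End Power.

Lemma pow_eval_continuous (I : Type) (i : I) :
  continuous (fun f : pow I => f i).
Proof.
exact: (@proj_continuous {classic I} (fun=> bs3) i).
Qed.

(* The empty index set is allowed, so the one-element semiring is a member. *)
Definition in_calA (A : pzSemiRingType) : Prop :=
  exists (I : Type) (f : {rmorphism A -> pow I}), injective f.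

Definition in_calX (X : relSpaceType) : Prop :=
  exists (I : Type) (C : set (pow I)), [/\ inhabited I, closed C &
    exists f : X -> set_type C, is_isomorphism f].

Definition is_hom (A B : pzSemiRingType) (f : A -> B) : Prop :=
  nmod_morphism f /\ monoid_morphism f.

Definition homs (A : pzSemiRingType) : set (pow A) :=
  [set f | @is_hom A bs3 f].

Definition D (A : pzSemiRingType) : relSpaceType := set_type (@homs A).

Definition morphisms (X : relSpaceType) : {pred pow X} :=
  [pred f : pow X | `[< @is_morphism X bs3 f >]].

Lemma cst_morphism (X : relSpaceType) (c : bs3) :
  @is_morphism X bs3 (fun=> c).
Proof. by split=> [|k x y _]; [exact: cst_continuous|case: k; case: c]. Qed.

Lemma op_morphism (X : relSpaceType) (op : bs3 -> bs3 -> bs3) (f g : X -> bs3) :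
  (forall k x y z t, rels k x y -> rels k z t -> rels k (op x z) (op y t)) ->
  is_morphism f -> is_morphism g -> is_morphism (fun x => op (f x) (g x)).
Proof.
move=> hop [cf rf] [cg rg]; split; last by move=> k x y xy; apply: hop; auto.
move=> x; apply/discrete_cvg.
have fx : nbhs x (f @^-1` [set f x]) by exact: (cf x _ (discrete_set1 _)).
have gx : nbhs x (g @^-1` [set g x]) by exact: (cg x _ (discrete_set1 _)).
move: fx gx; change (nbhs x (f @^-1` [set f x]) -> nbhs x (g @^-1` [set g x]) ->
  nbhs x [set y | op (f y) (g y) = op (f x) (g x)]).
by apply: filterS2 => y /= -> ->.
Qed.

Lemma morphisms_semiring_closed (X : relSpaceType) :
  semiring_closed (@morphisms X).
Proof.
split; split.
- by apply/asboolP; exact: (@cst_morphism X s0).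
- move=> f g /asboolP mf /asboolP mg; apply/asboolP.
  by apply: (@op_morphism X +%R _ _ _ mf mg); do 5!case.
- by apply/asboolP; exact: (@cst_morphism X s1).
- move=> f g /asboolP mf /asboolP mg; apply/asboolP.
  by apply: (@op_morphism X *%R _ _ _ mf mg); do 5!case.
Qed.

Record E (X : relSpaceType) : Type :=
  MkE { E_val : pow X; E_valP : E_val \in @morphisms X }.

HB.instance Definition _ (X : relSpaceType) := [isSub for @E_val X].
HB.instance Definition _ (X : relSpaceType) := [Choice of E X by <:].
HB.instance Definition _ (X : relSpaceType) :=
  GRing.SubChoice_isSubComPzSemiRing.Build (pow X) (@morphisms X) (E X)
    (@morphisms_semiring_closed X).

Lemma evalA_subproof (A : pzSemiRingType) (a : A) :
  ((fun x : D A => set_val x a) : pow (D A)) \in @morphisms (D A).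
Proof.
apply/asboolP; split; last by move=> k x y xy; exact: (xy a).
move=> x; apply: (@continuous_comp _ _ _ (set_val : D A -> pow A)
  (fun f : pow A => f a) x).
  exact: initial_continuous.
exact: pow_eval_continuous.
Qed.

Definition evalA (A : pzSemiRingType) (a : A) : E (D A) :=
  MkE (evalA_subproof a).

Lemma evalX_subproof (X : relSpaceType) (x : X) :
  ((fun f : E X => E_val f x) : pow (E X)) \in @homs (E X).
Proof. by apply/mem_set; split; split. Qed.

Definition evalX (X : relSpaceType) (x : X) : D (E X) :=
  SigSub (evalX_subproof x).

Definition yields_duality : Prop :=
  forall A : pzSemiRingType, in_calA A ->
    is_hom (@evalA A) /\ bijective (@evalA A).

Definition yields_full_duality : Prop :=
  yields_duality /\
  forall X : relSpaceType, in_calX X -> is_isomorphism (@evalX X).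

Definition bs3_injective : Prop :=
  forall (X : relSpaceType) (C : set X), in_calX X -> closed C ->
  forall g : set_type C -> bs3, is_morphism g ->
  exists2 f : X -> bs3, is_morphism f & forall c : set_type C, f (set_val c) = g c.

Definition yields_strong_duality : Prop :=
  yields_full_duality /\ bs3_injective.

(* Main.v *)
(* Duality.  The algebra [S] is a chain with [min] and [max] as term operations,
   hence has a median term.  Given a morphism [al : D A -> S], the relations
   [r_1], [r_2], [r_3] allow one to interpolate [al] at any two points of [D A]
   by an evaluation [e_A a].  By compactness of [D A * D A] finitely many [a]
   suffice for all pairs of points, and the median term merges them into a
   single [a] that interpolates [al] everywhere (Baker-Pixley).

   Failure of fullness.  Let [X] be the two-element substructure
   [{(0,h), (h,1)}] of [S^2].  Restricting functions to the two points identifies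
   [E X] with a subalgebra of [S^2] which, besides the two projections, admits
   further homomorphisms to [S], so [X -> D (E X)] is not surjective. *)
From mathcomp Require Import all_boot all_order all_algebra.
From mathcomp Require Import all_classical.
From mathcomp Require Import topology.
Require Import Defs.

Set Implicit Arguments.
Unset Strict Implicit.
Unset Printing Implicit Defensive.

Import GRing.Theory.
Local Open Scope classical_set_scope.
Local Open Scope ring_scope.

(** * Compactness and finite combinatorics *)

Lemma compact_set_type (X : topologicalType) (C : set X) :
  compact C -> compact [set: set_type C].
Proof.
move=> cC F PF FT.
have [|p [Cp clp]] := cC (set_val @ F) _.
  by change (F (set_val @^-1` C)); apply: (filterS _ FT) => x _; exact: set_valP.
have Cp' : p \in C by exact: mem_set.
exists (SigSub Cp'); split => // P Q FP.
rewrite /nbhs /= => -[_ [[O oO <-] /= Op OQ]].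
have [||y [[x Px <-] Ox]] := clp (set_val @` P) O.
- by rewrite nbhs_simpl /=; apply: filterS FP => x Px; exists x.
- by exact: open_nbhs_nbhs.
by exists x; split => //; exact: OQ.
Qed.

(* The library's [compact_cover] is only available on pointed spaces. *)
Lemma compact_subcover (X : topologicalType) (I : eqType) (V : I -> set X) :
  compact [set: X] -> (forall i, open (V i)) -> (forall x, exists i, V i x) ->
  exists s : seq I, forall x, exists2 i, i \in s & V i x.
Proof.
move=> cX oV cV; apply: contrapT => /forallNP nos.
pose F := [set W : set X |
  exists s : seq I, [set x | forall i, i \in s -> ~ V i x] `<=` W].
have FF : ProperFilter F.
  split.
    move=> [s sW]; apply: (nos s) => x; apply: contrapT => /forall2NP sx.
    by apply: (sW x) => i si; have [] := sx i.
  split; first by exists [::].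
    move=> P Q [s sP] [t tQ]; exists (s ++ t) => x stx.
    by split; [apply: sP|apply: tQ] => i si; apply: stx; rewrite mem_cat si ?orbT.
  by move=> P Q PQ [s sP]; exists s; exact: subset_trans PQ.
have [x [_ clx]] := cX F FF filterT.
have [i Vix] := cV x.
have [] := clx (~` V i) (V i).
- by exists [:: i] => y yi; apply: yi; rewrite mem_head.
- exact: open_nbhs_nbhs.
by move=> y [].
Qed.

(** Induction on [#|P|]: deleting each of three distinct elements in turn leaves three smaller sets,
    and every element of [P] lies in at least two of them, which is what a majority term can exploit
    in the third hypothesis. *)
Lemma majority_covering (T : finType) (G : {set T} -> Prop) :
  G finset.set0 -> (forall s t, G [set s; t]%SET) ->
  (forall (P : {set T}) x y z, x != y -> y != z -> x != z ->
    G (P :\ x)%SET -> G (P :\ y)%SET -> G (P :\ z)%SET -> G P) ->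
  forall P, G P.
Proof.
move=> G0 G2 G3 P; have [n] := ubnP #|P|; elim: n P => // n IHn P.
rewrite ltnS => Pn.
have [/card_gt2P[x [y [z [[xP yP zP] [xy yz zx]]]]]|] := ltnP 2 #|P|.
  have GD u : u \in P -> G (P :\ u)%SET.
    by move=> uP; apply: IHn; apply: leq_trans Pn; rewrite [X in (_ < X)%N](cardsD1 u) uP.
  rewrite eq_sym in zx; exact: (G3 P x y z xy yz zx (GD x xP) (GD y yP) (GD z zP)).
case: (set_0Vmem P) => [-> //|[x xP]] P2.
have : (#|P :\ x| <= 1)%N%SET by move: P2; rewrite (cardsD1 x) xP.
case: (set_0Vmem (P :\ x)%SET) => [P0 _|[y yP]].
  have -> : P = [set x; x]%SET by rewrite -(finset.setD1K xP) P0 finset.setU0 finset.setUid.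
  exact: G2.
move=> /card_le1P/(_ y yP) Py.
have -> : P = [set x; y]%SET.
  by rewrite -(finset.setD1K xP); congr finset.setU; apply/setP => u; rewrite Py !inE.
exact: G2.
Qed.

Lemma continuous_near_eq (X : topologicalType) (f : X -> bs3) (x : X) :
  {for x, continuous f} -> \forall y \near x, f y = f x.
Proof. by move=> cf; exact: (cf _ (discrete_set1 _)). Qed.

(** Neighbourhoods of [f] can fix any three coordinates. Three suffice for homomorphisms: two
    arguments and the result of a binary operation. *)
Lemma closed_pow_local3 (I : Type) (C : set (pow I)) :
  (forall f, (forall i j k,
     exists2 g, C g & [/\ g i = f i, g j = f j & g k = f k]) -> C f) ->
  closed C.
Proof.
move=> C3 f clf; apply: C3 => i j k.
pose V (l : I) := [set g : pow I | g l = f l].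
have fV l : nbhs f (V l) by exact: (continuous_near_eq (@pow_eval_continuous I l f)).
have [g [Cg [[gi gj] gk]]] := clf _ (filterI (filterI (fV i) (fV j)) (fV k)).
by exists g.
Qed.

Lemma compact_pow (I : eqType) : compact [set: pow I].
Proof.
have fin : compact [set: bs3] by apply: finite_compact; exact: finite_finset.
have := @tychonoff I (fun=> bs3) (fun=> setT) (fun=> fin).
suff -> : [set f : I -> bs3 | forall i, [set: bs3] (f i)] = setT by apply.
by rewrite predeqE.
Qed.

(* On [S] the inner [join] is [max], so [med] is the median of the chain. *)
Definition med (R : pzSemiRingType) (a b c : R) :=
  let join x y := x + y + x * y in join (join (a * b) (b * c)) (a * c).

Lemma med_bs3 (a b : bs3) : [/\ med a a b = a, med a b a = a & med b a a = a].
Proof. by case: a; case: b. Qed.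

(** * Interpolating morphisms on the dual space by evaluations *)

Section DualSpace.
Variable A : pzSemiRingType.

Lemma D_hom (x : D A) : is_hom (set_val x : A -> bs3).
Proof. by have := set_valP x. Qed.

Lemma D_med (x : D A) a b c :
  set_val x (med a b c) = med (set_val x a) (set_val x b) (set_val x c).
Proof.
case: (D_hom x) => -[x0 xD] [x1 xM].
by rewrite /med !(xD, xM).
Qed.

Lemma closed_homs : closed (@homs A).
Proof.
apply: closed_pow_local3 => f fP; split; split.
- by have [g [[g0 _] _] [<- _ _]] := fP 0 0 0.
- by move=> a b; have [g [[_ gD] _] [<- <- <-]] := fP (a + b) a b.
- by have [g [_ [g1 _]] [<- _ _]] := fP 1 1 1.
- by move=> a b; have [g [_ [_ gM]] [<- <- <-]] := fP (a * b) a b.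
Qed.

Lemma compact_D : compact [set: D A].
Proof.
apply: compact_set_type; apply: subclosed_compact closed_homs (@compact_pow A) _.
exact: subsetT.
Qed.

(* The pairs [(x a, y a)] form a subalgebra of [S^2], and every subalgebra of
   [S^2] is an intersection of [r_1], [r_2], [r_3] and their converses. *)
Lemma pair_interpolation (al : D A -> bs3) (x y : D A) :
  is_morphism al ->
  exists a, set_val x a = al x /\ set_val y a = al y.
Proof.
move=> [_ mal].
have [[[x0 xD] [x1 xM]] [[y0 yD] [y1 yM]]] := (D_hom x, D_hom y).
have [//|N] := pselect (exists a, set_val x a = al x /\ set_val y a = al y).
have {N} N a : ~~ ((set_val x a == al x) && (set_val y a == al y)).
  by apply/negP => /andP[/eqP xa /eqP ya]; apply: N; exists a.
pose miss p q := ~~ ((p == al x) && (q == al y)).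
(* If no element attains the target pair, then no [(x a, y a)] is sent to it by adding [1] or [h] or
   by multiplying by [h]. *)
have Na a : let p := set_val x a in let q := set_val y a in
    [/\ miss p q, miss (p + s1) (q + s1), miss (p + sh) (q + sh) &
        miss (p * sh) (q * sh)].
  by split; [have := N a|have := N (a + 1)|have := N (a + (1 + 1))|
    have := N (a * (1 + 1))]; rewrite ?(xD, yD, xM, yM, x1, y1).
have rel k (u v : D A) :
    (forall a, bs3_rels k (set_val u a) (set_val v a)) ->
    bs3_rels k (al u) (al v) by exact: (mal k u v).
suff : false by [].
(* The elements [0], [1], [1 + 1] realise the diagonal, leaving six targets. Each violates some
   relation or its converse, although by [Na] all pairs [(x a, y a)] satisfy it. *)
have := (N 0, N 1, N (1 + 1)); rewrite !(x0, x1, y0, y1, xD, yD) => -[[]].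
move: (rel R1 x y) (rel R1 y x) (rel R2 x y) (rel R2 y x) (rel R3 x y) Na.
rewrite /miss; case: (al x) (al y) => -[] //= r1 r1' r2 r2' r3 Na _ _ _.
- by apply: r2' => a; have := Na a;
    case: (set_val x a) (set_val y a) => -[] //= [].
- by apply: r1' => a; have := Na a;
    case: (set_val x a) (set_val y a) => -[] //= [].
- by apply: r2 => a; have := Na a;
    case: (set_val x a) (set_val y a) => -[] //= [].
- by apply: r3 => a; have := Na a;
    case: (set_val x a) (set_val y a) => -[] //= [].
- by apply: r1 => a; have := Na a;
    case: (set_val x a) (set_val y a) => -[] //= [].
- by apply: r3 => a; have := Na a;
    case: (set_val x a) (set_val y a) => -[] //= [].
Qed.

Lemma interpolation (al : D A -> bs3) :
  is_morphism al -> exists a, forall x, set_val x a = al x.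
Proof.
move=> mal; pose U a := [set x : D A | set_val x a = al x].
have oU a : open (U a).
  rewrite openE => x /= xa.
  have /asboolP[ca _] := evalA_subproof a.
  near=> y; rewrite /U /=.
  by rewrite (near (continuous_near_eq (mal.1 x)) y) // -xa
     (near (continuous_near_eq (ca x)) y).
have cDD : compact [set: D A * D A].
  by have := compact_setX compact_D compact_D; rewrite setXTT.
have [||s sU] := @compact_subcover _ _ (fun a => U a `*` U a) cDD.
- move=> a; rewrite openE => -[x y] [xa ya]; exists (U a, U a) => [|//].
  by split; [exact: (open_nbhs_nbhs (conj (oU a) xa))
            |exact: (open_nbhs_nbhs (conj (oU a) ya))].
- by move=> [x y]; have [a [xa ya]] := pair_interpolation x y mal; exists a.
(* Points with the same signature lie in the same [U a], [a \in s], which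
   reduces the infinite space [D A] to a finite set. *)
pose sig (x : D A) := [ffun a : seq_sub s => set_val x (ssval a) == al x].
pose G (P : {set {ffun seq_sub s -> bool}}) :=
  exists a, forall x, sig x \in P -> U a x.
have Gsig x y : exists a, forall z, sig z = sig x \/ sig z = sig y -> U a z.
  have [a sa [/= Uax Uay]] := sU (x, y); exists a => z.
  have sigE u : sig u (SeqSub sa) = (set_val u a == al u) by rewrite ffunE.
  by move=> [] /(congr1 (fun t : {ffun seq_sub s -> bool} => t (SeqSub sa)));
     rewrite !sigE => zE; apply/eqP; rewrite zE; apply/eqP.
have [|||a Ga] := @majority_covering _ G _ _ _ [set: {ffun seq_sub s -> bool}]%SET.
- by exists 0 => x; rewrite inE.
- move=> t u.
  (* Signatures realised by no point impose no condition. *)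
  have [[x <-]|nt] := pselect (exists x, sig x = t);
    have [[y <-]|nu] := pselect (exists y, sig y = u).
  + have [a aP] := Gsig x y; exists a => z.
    by rewrite !inE => /orP[]/eqP zE; apply: aP; [left|right].
  + have [a aP] := Gsig x x; exists a => z.
    rewrite !inE => /orP[]/eqP zE; first by apply: aP; left.
    by case: nu; exists z.
  + have [a aP] := Gsig y y; exists a => z.
    rewrite !inE => /orP[]/eqP zE; last by apply: aP; left.
    by case: nt; exists z.
  by exists 0 => z; rewrite !inE => /orP[]/eqP zE; [case: nt|case: nu]; exists z.
- move=> P p q r pq qr pr [a aP] [b bP] [c cP]; exists (med a b c) => x xP.
  rewrite /U /= D_med.
  (* [sig x] differs from at least two of [p], [q], [r], so two of the three arguments of [med]
     equal [al x]. *)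
  have maj w := med_bs3 (al x) w.
  have [xp|xp] := eqVneq (sig x) p.
    have -> : set_val x b = al x by apply: bP; rewrite !inE xP xp pq.
    have -> : set_val x c = al x by apply: cP; rewrite !inE xP xp pr.
    by case: (maj (set_val x a)).
  have -> : set_val x a = al x by apply: aP; rewrite !inE xP xp.
  have [xq|xq] := eqVneq (sig x) q.
    have -> : set_val x c = al x by apply: cP; rewrite !inE xP xq qr.
    by case: (maj (set_val x b)).
  have -> : set_val x b = al x by apply: bP; rewrite !inE xP xq.
  by case: (maj (set_val x c)).
by exists a => x; apply: Ga; rewrite inE.
Unshelve. all: by end_near.
Qed.

End DualSpace.

Lemma duality : yields_duality.
Proof.
move=> A [I [f f_inj]].
have E_inj : injective (@E_val (D A)) by exact: val_inj.
split.
  by split; split => [|a b]; apply: E_inj; apply/funext => x;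
    have [[x0 xD] [x1 xM]] := D_hom x; [exact: x0|exact: xD|exact: x1|exact: xM].
have ev_inj : injective (@evalA A).
  move=> a b eab; apply: f_inj; apply/funext => i.
  (* The coordinates of the embedding [f] are points of [D A] and separate the elements of [A]. *)
  have xhom : @homs A (fun c => f c i).
    split; split; rewrite ?rmorph0 ?rmorph1 // => c d.
      by rewrite rmorphD.
    by rewrite rmorphM.
  by have := congr1 (fun g : E (D A) => E_val g (SigSub (mem_set xhom))) eab.
have ev_surj (g : E (D A)) : exists a, evalA a = g.
  have /asboolP mg := E_valP g.
  have [a ag] := interpolation mg.
  by exists a; apply: E_inj; apply/funext.
have [h hK] := choice ev_surj.
by exists h => // a; apply: ev_inj; rewrite hK.
Qed.

(** * A two-point structure refuting fullness *)

Definition two_pt : set (pow bool) :=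
  [set (fun b => if b then sh else s0); (fun b => if b then s1 else sh)].

Lemma closed_two_pt : closed two_pt.
Proof.
apply: closed_pow_local3 => f /(_ true false false) [g gP [gt gf _]].
suff <- : g = f by [].
by apply/funext => -[].
Qed.

Definition pt1 : set_type two_pt := SigSub (mem_set (or_introl erefl)).
Definition pt2 : set_type two_pt := SigSub (mem_set (or_intror erefl)).

Lemma two_pt_in_calX : in_calX (set_type two_pt).
Proof.
exists bool, two_pt; split; [exact: (inhabits true)|exact: closed_two_pt|].
have mid : @is_morphism (set_type two_pt) (set_type two_pt) id.
  by split => // x; exact: cvg_id.
by exists id; split => //; exists id; split.
Qed.

Lemma coord_subproof (I : Type) (C : set (pow I)) (i : I) :
  ((fun x : set_type C => set_val x i) : pow (set_type C))
    \in @morphisms (set_type C).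
Proof.
apply/asboolP; split; last by move=> k x y; exact.
move=> x; apply: (@continuous_comp _ _ _ (set_val : set_type C -> pow I)
  (fun f : pow I => f i) x).
  exact: initial_continuous.
exact: pow_eval_continuous.
Qed.

Definition coord (I : Type) (C : set (pow I)) (i : I) : E (set_type C) :=
  MkE (coord_subproof C i).

(* On the subalgebra [{(0,0), (0,h), (h,h), (h,1), (1,h), (1,1)}] of [S^2], the
   map [glue] is a homomorphism different from both projections. *)
Definition glue (p q : bs3) : bs3 :=
  match p, q with
  | s0, _ => s0
  | _, s1 => s1
  | _, _ => sh
  end.

Definition phantom (f : E (set_type two_pt)) : bs3 :=
  glue (E_val f pt1) (E_val f pt2).

(** The relations between [pt1] and [pt2] exclude the value pairs [(1,0)], [(0,1)] and [(h,0)],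
    leaving the six on which [glue] respects the operations. *)
Lemma phantom_hom : homs phantom.
Proof.
have two_rels (f : E (set_type two_pt)) (p := E_val f pt1) (q := E_val f pt2) :
    [/\ bs3_rels R1 p q, bs3_rels R1 q p & bs3_rels R2 p q].
  have /asboolP[_ mf] := E_valP f.
  have m k u v : rels k u v -> bs3_rels k (E_val f u) (E_val f v) by exact: mf.
  by split; [apply: (m R1 pt1 pt2)|apply: (m R1 pt2 pt1)|apply: (m R2 pt1 pt2)];
    case.
split; split => // f g; move: (two_rels f) (two_rels g).
  change (phantom (f + g)) with
    (glue (E_val f pt1 + E_val g pt1) (E_val f pt2 + E_val g pt2)).
  rewrite /phantom.
  by case: (E_val f pt1) (E_val f pt2) (E_val g pt1) (E_val g pt2)
    => -[] -[] -[] // [] // _ _ _ [].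
change (phantom (f * g)) with
  (glue (E_val f pt1 * E_val g pt1) (E_val f pt2 * E_val g pt2)).
rewrite /phantom.
by case: (E_val f pt1) (E_val f pt2) (E_val g pt1) (E_val g pt2)
  => -[] -[] -[] // [] // _ _ _ [].
Qed.

Lemma not_full : ~ yields_full_duality.
Proof.
move=> [_ /(_ _ two_pt_in_calX)[_ [g [_ _ gK]]]].
have := gK (SigSub (mem_set phantom_hom)).
set x := g _ => xE.
have ev b : set_val x b = phantom (coord two_pt b).
  exact: (congr1 (fun y : D (E (set_type two_pt)) => set_val y (coord two_pt b)) xE).
(* A point inducing [phantom] would have coordinates [glue 0 h = 0] at [false] and [glue h 1 = 1] at
   [true], but [(0,1)] is not in [two_pt]. *)
have : (set_val x true, set_val x false) = (s1, s0) by rewrite !ev.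
have xP : two_pt (set_val x) := set_valP x.
by case: xP => ->.
Qed.

Theorem theorem6 :
  yields_duality /\ ~ yields_full_duality /\ ~ yields_strong_duality.
Proof.
by split; [exact: duality|split=> [|[full _]]; exact: not_full].
Qed.
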